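(* Let $d\ge3$ and let $K:\mathbb{S}^{d-1}\times\mathbb{S}^{d-1}\to\mathbb{C}$ be a Hermitian, axially symmetric kernel of the form $$K(\xi,\zeta)=\sum_{\ell_1=-\infty}^{\infty}\ \sum_{\ell,\ell'\in\Lambda_{|\ell_1|}}c_{\ell_1}(\ell,\ell')\,Y_{\ell_1,\ell}(\xi)\,\overline{Y_{\ell_1,\ell'}(\zeta)},\qquad \xi,\zeta\in\mathbb{S}^{d-1},$$ with $$\sum_{\ell_1=-\infty}^{\infty}\ \sum_{\ell,\ell'\in\Lambda_{|\ell_1|}}|c_{\ell_1}(\ell,\ell')|\,\frac{\sqrt{N_{\ell_{d-1},d}N_{\ell'_{d-1},d}}}{\sigma_{d-1}}<\infty .$$ If for every $\ell_1\in\mathbb{Z}$ the mapping $c_{\ell_1}:\Lambda_{|\ell_1|}\times\Lambda_{|\ell_1|}\to\mathbb{C}$ is positive definite, then $K$ is positive definite on $\mathbb{S}^{d-1}$.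
   Context: A Hermitian kernel $K:\Omega\times\Omega\to\mathbb{C}$ ($K(x,y)=\overline{K(y,x)}$) is called positive definite on $\Omega$ if for every finite set $\Xi\subset\Omega$ of distinct points the matrix $(K(\xi,\zeta))_{\xi,\zeta\in\Xi}$ is positive semi-definite on $\mathbb{C}^{|\Xi|}$. $\mathbb{S}^{d-1}$ is the unit sphere in $\mathbb{R}^d$ and $\sigma_{d-1}$ its surface area. $N_{0,d}=1$, $N_{j,d}=\frac{(2j+d-2)(j+d-3)!}{j!(d-2)!}$ for $j\ge1$. For $\ell_1\in\mathbb{Z}$, $\Lambda_{|\ell_1|}=\{\ell=(\ell_2,\ldots,\ell_{d-1})\in\mathbb{Z}^{d-2}:|\ell_1|\le\ell_2\le\cdots\le\ell_{d-1}\}$. In polar coordinates $\xi=(\theta_1,\ldots,\theta_{d-1})$, $\theta_1\in[0,2\pi)$, $\theta_j\in[0,\pi]$ for $j\ge2$ ($\xi_d=\cos\theta_{d-1}$, $\xi_{d-1}=\sin\theta_{d-1}\cos\theta_{d-2}$, ..., $\xi_2=\sin\theta_{d-1}\cdots\sin\theta_2\sin\theta_1$, $\xi_1=\sin\theta_{d-1}\cdots\sin\theta_2\cos\theta_1$), the functions $$Y_{\ell_1,\ell}(\xi)=Y_{\ell_1,\ldots,\ell_{d-1}}(\xi)=\frac{1}{\sqrt{2\pi}}e^{i\ell_1\theta_1}\prod_{j=2}^{d-1}{}_{j}\tilde P_{\ell_j}^{\ell_{j-1}}(\theta_j)$$ form an orthonormal basis of $L^2(\mathbb{S}^{d-1})$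 of spherical harmonics ($Y_{\ell_1,\ell}$ has degree $\ell_{d-1}$), where ${}_{j}\tilde P_{L}^{\ell}(\theta)={}_{j}c_L^{\ell}(\sin\theta)^{(2-j)/2}P_{L+(j-2)/2}^{-(\ell+(j-2)/2)}(\cos\theta)$ (extended continuously to $\theta\in\{0,\pi\}$), $P_\nu^\mu$ are the associated Legendre functions on $(-1,1)$ and ${}_{j}c_L^{\ell}=\left(\frac{2L+j-1}{2}\frac{(L+\ell+j-2)!}{(L-\ell)!}\right)^{1/2}$. Axially symmetric means invariant under simultaneous rotation $\theta_1\mapsto\theta_1+\alpha$ of both arguments for every $\alpha$ (every kernel of the displayed form has this property). *)

(* Defs.v *)
From HB Require Import structures.
From mathcomp Require Import all_boot all_order all_algebra.
From mathcomp Require Import complex.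
From mathcomp Require Import all_classical all_reals all_analysis.
From mathcomp.analysis.showcase Require Import summability.

Set Implicit Arguments.
Unset Strict Implicit.
Unset Printing Implicit Defensive.
Import Order.TTheory GRing.Theory Num.Theory numFieldNormedType.Exports.
Local Open Scope classical_set_scope.
Local Open Scope ring_scope.

(* Unordered summation over D, that is, convergence along the net of finite
   subsets.  R[i] carries its topology only under the alias R[i]^o. *)
Definition has_sum (R : realType) (I : choiceType) (D : set I)
    (f : I -> R[i]) (s : R[i]) : Prop :=
  partial_sum (fun i => if i \in D then f i else 0 : R[i]^o) @ totally
    --> (s : R[i]^o).

Definition hermitian_on (R : realType) (T : Type) (Omega : set T)
    (K : T -> T -> R[i]) : Prop :=
  forall x y, Omega x -> Omega y -> K x y = (K y x)^*.

Definition psdmx (R : realType) (n : nat) (A : 'M[R[i]]_n) : Prop :=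
  forall v : 'cV[R[i]]_n, 0 <= (map_mx Num.conj v^T *m A *m v) 0 0.

(* The values of K outside Omega are irrelevant.  A finite set of n distinct
   points of Omega is given by an injective enumeration. *)
Definition posdef_on (R : realType) (T : Type) (Omega : set T)
    (K : T -> T -> R[i]) : Prop :=
  hermitian_on Omega K /\
  forall (n : nat) (x : 'I_n -> T), injective x -> (forall i, Omega (x i)) ->
    psdmx (\matrix_(i, j) K (x i) (x j)).

Definition sphere (R : realType) (d : nat) : set 'rV[R]_d :=
  [set x | \sum_(i < d) x 0 i ^+ 2 = 1].

(* A tuple of angles is a function theta on nat of which only
   theta 1, ..., theta (d - 1) are used.  The coordinate of index i : 'I_d
   is the Cartesian coordinate xi_(i+1). *)
Definition polar (R : realType) (d : nat) (theta : nat -> R) : 'rV[R]_d :=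
  \row_(i < d)
    match nat_of_ord i with
    | 0%N => cos (theta 1%N) * \prod_(2 <= j < d) sin (theta j)
    | 1%N => sin (theta 1%N) * \prod_(2 <= j < d) sin (theta j)
    | k => cos (theta k) * \prod_(k.+1 <= j < d) sin (theta j)
    end.

Definition polar_range (R : realType) (d : nat) : set (nat -> R) :=
  [set theta | 0 <= theta 1%N < 2 * pi /\
               forall j, (2 <= j < d)%N -> 0 <= theta j <= pi].

(* Polar angles of a point of the sphere.  They are not unique where some
   sin (theta j), j >= 2, vanishes, but for l in Lambda l1 the function Y l1 l
   below does not depend on the choice. *)
Definition angles (R : realType) (d : nat) (xi : 'rV[R]_d) : nat -> R :=
  xget (fun=> 0) [set theta | polar_range d theta /\ polar d theta = xi].

Definition shift_angle (R : realType) (alpha : R) (theta : nat -> R)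
    : nat -> R :=
  fun j => if j == 1%N then theta j + alpha else theta j.

(* theta 1 + alpha need not be reduced modulo 2 pi, as polar is periodic. *)
Definition axially_symmetric (R : realType) (d : nat)
    (K : 'rV[R]_d -> 'rV[R]_d -> R[i]) : Prop :=
  forall (alpha : R) (theta theta' : nat -> R),
    polar_range d theta -> polar_range d theta' ->
    K (polar d (shift_angle alpha theta)) (polar d (shift_angle alpha theta'))
    = K (polar d theta) (polar d theta').

(* Surface area of the unit sphere of R^d: the integral of the surface element
   \prod_(2 <= j < d) (sin theta_j)^(j-1) over the range of the angles. *)
Definition sphere_area (R : realType) (d : nat) : R :=
  2 * pi * \prod_(2 <= j < d)
    (\int[@lebesgue_measure R]_(t in `[0, pi]) (sin t ^+ j.-1)).

(* Dimension of the space of spherical harmonics of degree j in dimension d. *)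
Definition harm_dim (R : realType) (j d : nat) : R :=
  if j == 0%N then 1
  else (((2 * j + d - 2) * (j + d - 3)`!)%N)%:R / ((j`! * (d - 2)`!)%N)%:R.

(* 1 / Gamma(x) by Gauss' product; it is entire and vanishes at
   x = 0, -1, -2, ... *)
Definition rGamma (R : realType) (x : R) : R :=
  limn (fun n : nat =>
    (\prod_(k < n.+1) (x + k%:R)) / (n`!%:R * n%:R `^ x)).

Definition pochhammer (R : realType) (a : R) (k : nat) : R :=
  \prod_(i < k) (a + i%:R).

(* Ferrers function of the first kind on (-1, 1):
   P_nu^mu(x) = ((1 + x) / (1 - x))^(mu/2) F(nu + 1, - nu; 1 - mu; (1 - x) / 2)
   where F(a, b; c; z) = \sum_k (a)_k (b)_k / (Gamma(c + k) k!) z^k is the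
   regularized hypergeometric function: mu = 1, 2, ... are allowed, which
   occurs below for j = 2 and a negative l_1. *)
Definition legendreP (R : realType) (nu mu x : R) : R :=
  ((1 + x) / (1 - x)) `^ (mu / 2) *
  limn (series (fun k : nat =>
    pochhammer (nu + 1) k * pochhammer (- nu) k * rGamma (1 - mu + k%:R)
      / k`!%:R * ((1 - x) / 2) ^+ k)).

Definition cnorm (R : realType) (j : nat) (L l : int) : R :=
  Num.sqrt ((2 * L%:~R + j%:R - 1) / 2
            * ((absz (L + l + j%:Z - 2)%R)`!)%:R / ((absz (L - l)%R)`!)%:R).

Definition Ptilde_open (R : realType) (j : nat) (L l : int) (t : R) : R :=
  cnorm R j L l * sin t `^ ((2 - j%:R) / 2)
  * legendreP (L%:~R + (j%:R - 2) / 2) (- (l%:~R + (j%:R - 2) / 2)) (cos t).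

Definition Ptilde (R : realType) (j : nat) (L l : int) (t : R) : R :=
  if 0 < t < pi then Ptilde_open j L l t
  else lim (Ptilde_open j L l s @[s --> within `]0, pi[ (nbhs t)]).

(* The tuple l = (l_2, ..., l_(d-1)) is indexed from 0. *)
Definition Lambda (d : nat) (l1 : int) : set ((d - 2).-tuple int) :=
  [set l | path (fun a b : int => a <= b) `|l1| l].

Definition mindex (d : nat) (l1 : int) (l : (d - 2).-tuple int) (j : nat)
    : int :=
  nth 0 (l1 :: l) j.-1.

Definition Y (R : realType) (d : nat) (l1 : int) (l : (d - 2).-tuple int)
    (xi : 'rV[R]_d) : R[i] :=
  let theta := angles xi in
  (Num.sqrt (2 * pi))^-1%:C%C
  * (cos (l1%:~R * theta 1%N) +i* sin (l1%:~R * theta 1%N))%C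
  * (\prod_(2 <= j < d)
      Ptilde j (mindex l1 l j) (mindex l1 l j.-1) (theta j))%:C%C.

Definition degree (d : nat) (l1 : int) (l : (d - 2).-tuple int) : nat :=
  `|mindex l1 l d.-1|%N.

(* K(xi, zeta) = \sum_(l1 in Z) \sum_(l, l' in Lambda l1) ..., as an iterated
   sum; S xi zeta l1 is the value of the inner sum. *)
Definition has_expansion (R : realType) (d : nat)
    (c : int -> (d - 2).-tuple int -> (d - 2).-tuple int -> R[i])
    (K : 'rV[R]_d -> 'rV[R]_d -> R[i]) : Prop :=
  forall xi zeta, @sphere R d xi -> @sphere R d zeta ->
  exists S : int -> R[i],
    (forall l1, has_sum (@Lambda d l1 `*` @Lambda d l1)
       (fun p => c l1 p.1 p.2 * Y l1 p.1 xi * (Y l1 p.2 zeta)^*) (S l1)) /\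
    has_sum [set: int] S (K xi zeta).

Definition coef_summable (R : realType) (d : nat)
    (c : int -> (d - 2).-tuple int -> (d - 2).-tuple int -> R[i]) : Prop :=
  (\esum_(l1 in [set: int]) \esum_(p in @Lambda d l1 `*` @Lambda d l1)
     (ComplexField.Normc.normc (c l1 p.1 p.2)
      * (Num.sqrt (harm_dim R (degree l1 p.1) d * harm_dim R (degree l1 p.2) d)
         / sphere_area R d))%:E < +oo)%E.

(* Main.v *)
Require Import Defs.
From mathcomp Require Import all_boot all_order all_algebra.
From mathcomp Require Import complex finmap ring.
From mathcomp Require Import all_classical all_reals all_analysis.
From mathcomp.analysis.showcase Require Import summability.

(** For weights v_1, ..., v_n and points x_1, ..., x_n put
    g(l) = \sum_i v_i^* Y_(l1,l)(x_i).  The quadratic form of K is the sum over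
    l1 of the limits, along finite subsets of Lambda x Lambda, of the sums of
    c_l1(l, l') g(l) g(l')^*.  The squares F x F are cofinal among these finite
    subsets and the sum over a square is a value of the quadratic form of c_l1,
    so the limit is nonnegative. *)

Set Implicit Arguments.
Unset Strict Implicit.
Unset Printing Implicit Defensive.
Import Order.TTheory GRing.Theory Num.Theory numFieldNormedType.Exports.
Local Open Scope classical_set_scope.
Local Open Scope ring_scope.
#[local] Existing Instance totally_filter.

Lemma psdmxE (R : realType) (n : nat) (A : 'M[R[i]]_n) (v : 'cV[R[i]]_n) :
  (map_mx Num.conj v^T *m A *m v) 0 0 =
  \sum_i \sum_j (v i 0)^* * v j 0 * A i j.
Proof.
rewrite exchange_big mxE; apply: eq_bigr => j _; rewrite mxE mulr_suml.
by apply: eq_bigr => i _; rewrite !mxE mulrAC.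
Qed.

(** [K] may be only partially ordered, so [s] is shown to equal its modulus. A nonnegative [f t] is
    its own modulus, hence at least as close to the modulus of [s] as to [s]; it cannot lie within
    half their distance of [s]. *)
Lemma frequently_ge0_lim (K : numFieldType) (T : Type) (F : set_system T)
    {FF : Filter F} (f : T -> K^o) (s : K) :
  f @ F --> (s : K^o) ->
  (forall P : set T, F P -> exists2 t, P t & 0 <= (f t : K)) -> 0 <= s.
Proof.
move=> /cvgrPdist_lt fs f_ge0; suff -> : s = `|s| by [].
apply/eqP; rewrite eq_sym -subr_eq0 -normr_eq0; apply: contraT => s_neq0.
have e_gt0 : 0 < `| `|s| - s| / 2 by rewrite divr_gt0 // lt_def s_neq0 /=.
have [t st ft] := f_ge0 _ (fs _ e_gt0); move: st => /= st.
suff : `| `|s| - s| < `| `|s| - s| by rewrite ltxx.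
rewrite [X in _ < X]splitr; apply: le_lt_trans (ltrD st st).
rewrite -[ `|s| - s](subrKA (f t)); apply: le_trans (ler_normD _ _) _.
rewrite [ `|f t - s|]distrC lerD2r -{1}(ger0_norm ft).
exact: ler_dist_dist.
Qed.

(** Each set of the filter [totally] contains all finite supersets of some [A], so a cofinal family
    of nonnegative partial sums suffices. *)
Lemma has_sum_ge0 (R : realType) (I : choiceType) (D : set I) (f : I -> R[i])
    (s : R[i]) :
  has_sum D f s ->
  (forall A : {fset I}, exists2 B : {fset I}, (A `<=` B)%fset &
     0 <= \sum_(i <- B | i \in D) f i) ->
  0 <= s.
Proof.
move=> fs f_ge0; apply: frequently_ge0_lim fs _ => P [A _ AP].
have [B AB B_ge0] := f_ge0 A; exists B; first exact: AP.
by move: B_ge0; rewrite big_mkcond big_seq_fsetE.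
Qed.

(** With [J] the pairs of point indices, this moves the quadratic form of the kernel inside the
    outer and the inner sums. *)
Lemma has_sum_lin (R : realType) (I : choiceType) (D : set I) (J : finType)
    (a : J -> R[i]) (f : J -> I -> R[i]) (s : J -> R[i]) :
  (forall j, has_sum D (f j) (s j)) ->
  has_sum D (fun i => \sum_j a j * f j i) (\sum_j a j * s j).
Proof.
move=> fs; rewrite /has_sum.
have -> : partial_sum
    (fun i => if i \in D then \sum_j a j * f j i else 0 : R[i]^o) =
  fun A => \sum_j (a j : R[i]^o) *
    partial_sum (fun i => if i \in D then f j i else 0 : R[i]^o) A.
  apply/funext => A; rewrite /partial_sum.
  under [RHS]eq_bigr do rewrite mulr_sumr.
  rewrite exchange_big; apply: eq_bigr => i _ /=.
  by case: ifP => // _; rewrite big1 // => j _; rewrite mulr0.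
apply: (cvg_big (U := R[i]^o) add_continuous) => j _.
by apply: (@cvgMl_tmp R[i]); exact: fs.
Qed.

Lemma posdef_on_ge0 (R : realType) (T : eqType) (Omega : set T)
    (k : T -> T -> R[i]) (g : T -> R[i]) (s : seq T) :
  posdef_on Omega k -> uniq s -> (forall x, x \in s -> Omega x) ->
  0 <= \sum_(x <- s) \sum_(y <- s) g x * (g y)^* * k x y.
Proof.
move=> [_ k_psd] s_uniq sOmega.
have s_inj : injective (tnth (in_tuple s)) by exact/tuple_uniqP.
have sP i : Omega (tnth (in_tuple s) i) by apply: sOmega; exact: mem_tnth.
(* The vector is the conjugate of [g] because [psdmx] conjugates its left factor. *)
have := k_psd _ _ s_inj sP (\col_i (g (tnth (in_tuple s) i))^*).
rewrite psdmxE; under eq_bigr do under eq_bigr do rewrite !mxE conjCK.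
rewrite [X in _ -> 0 <= X]big_tnth.
by under [X in _ -> 0 <= X]eq_bigr do rewrite big_tnth.
Qed.

Lemma has_sum_square_ge0 (R : realType) (T : choiceType) (Omega : set T)
    (k : T -> T -> R[i]) (g : T -> R[i]) (s : R[i]) :
  posdef_on Omega k ->
  has_sum (Omega `*` Omega) (fun p => g p.1 * (g p.2)^* * k p.1 p.2) s ->
  0 <= s.
Proof.
move=> k_pd ks; apply: has_sum_ge0 ks _ => A.
(* Both coordinates of the pairs in [A] go into [F], so that its square contains [A]. *)
pose F := ([fset p.1 | p in A] `|` [fset p.2 | p in A])%fset.
exists (F `*` F)%fset.
  apply/fsubsetP => p pA; rewrite in_fsetM !in_fsetU.
  by rewrite !in_imfset // orbT.
(* Listing the square row by row turns the sum over pairs into a double sum. *)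
rewrite (perm_big [seq (x, y) | x <- F, y <- F]); last first.
  apply: uniq_perm; first exact: fset_uniq.
    by apply: allpairs_uniq => // -[? ?] [? ?].
  move=> [x y]; rewrite in_fsetM /=.
  apply/andP/allpairsP => [[xF yF]|[[x' y'] /= [xF yF [-> ->]]]//].
  by exists (x, y).
rewrite big_mkcond big_allpairs.
(* Positive definiteness concerns points of [Omega] only; the other points of [F] contribute zero
   and are filtered out. *)
have -> : \sum_(x <- F) \sum_(y <- F) (if (x, y) \in Omega `*` Omega
    then g x * (g y)^* * k x y else 0) =
  \sum_(x <- [seq x <- F | x \in Omega]) \sum_(y <- [seq x <- F | x \in Omega])
    g x * (g y)^* * k x y.
  rewrite big_filter [RHS]big_mkcond; apply: eq_bigr => x _.
  under eq_bigr do rewrite classical_sets.in_setX /=.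
  case: ifP => _ /=; last by rewrite big1.
  by rewrite big_filter [RHS]big_mkcond.
apply: posdef_on_ge0 k_pd _ _; first by rewrite filter_uniq // fset_uniq.
by move=> x; rewrite mem_filter => /andP[/set_mem].
Qed.

Theorem theorem2 (R : realType) (d : nat) (hd : (3 <= d)%N)
  (K : 'rV[R]_d -> 'rV[R]_d -> R[i])
  (c : int -> (d - 2).-tuple int -> (d - 2).-tuple int -> R[i])
  (K_herm : hermitian_on (@sphere R d) K)
  (K_axial : axially_symmetric K)
  (K_expansion : has_expansion c K)
  (c_summable : coef_summable c)
  (c_posdef : forall l1 : int, posdef_on (@Lambda d l1) (c l1)) :
  posdef_on (@sphere R d) K.
Proof.
split=> // n x _ x_sphere v; rewrite psdmxE pair_bigA /=.
(* The inner sums depend on the pair of points; one family is fixed for each pair of indices. *)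
have [S S_sum] := choice (fun p : 'I_n * 'I_n =>
  K_expansion _ _ (x_sphere p.1) (x_sphere p.2)).
under eq_bigr do rewrite mxE.
have :=
  has_sum_lin (a := fun p => (v p.1 0)^* * v p.2 0) (fun p => (S_sum p).2).
(* In the outer sum every term is nonnegative, so no finite set needs enlarging. *)
move/has_sum_ge0; apply=> A; exists A; first exact: fsubset_refl.
apply: sumr_ge0 => l1 _.
have sum_l1 :=
  has_sum_lin (a := fun p => (v p.1 0)^* * v p.2 0) (fun p => (S_sum p).1 l1).
pose g l := \sum_i (v i 0)^* * Y l1 l (x i).
apply: (has_sum_square_ge0 (g := g) (c_posdef l1)).
move: sum_l1; congr has_sum.
(* Expanding [g l * (g l')^*] gives a sum over pairs of indices, in which the second conjugation
   restores [v j 0]. *)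
apply/funext => -[l l'] /=; rewrite /g rmorph_sum mulr_suml mulr_suml.
rewrite -(pair_bigA _ (fun i j => (v i 0)^* * v j 0 *
  (c l1 l l' * Y l1 l (x i) * (Y l1 l' (x j))^*))) /=.
apply: eq_bigr => i _; rewrite mulr_sumr mulr_suml; apply: eq_bigr => j _.
by rewrite [X in _ = _ * X * _]rmorphM /= conjCK; ring.
Qed.
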